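(* Let $g\in L^2(\mathbb R)$ be compactly supported and such that $G=\{E_{mb}T_{na}g\}_{m,n\in\mathbb Z}$ is a frame for $L^2(\mathbb R)$ for some $a,b>0$. Assume that there is a compactly supported function $g^d\in L^2(\mathbb R)$ such that $G^d=\{E_{mb}T_{na}g^d\}_{m,n\in\mathbb Z}$ is a dual frame of $G$. Then there is a finite set $K\subset\mathbb Z$ (dependent only on $g$, $g^d$ and $a$) such that the compactly supported dual windows of $G$ are precisely the functions of the form $$\phi = g^d+w-\sum_{k\in K}\sum_{j\in\mathbb Z}\langle g^d,E_{jb}T_{ka}g\rangle\, E_{jb}T_{ka}w,$$ where $w\in L^2(\mathbb R)$ is compactly supported and such that $\{E_{mb}T_{na}w\}_{m,n\in\mathbb Z}$ is a Bessel sequence in $L^2(\mathbb R)$.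
   Context: For $\nu,t\in\mathbb R$, the modulation and translation operators on $L^2(\mathbb R)$ are $(E_\nu f)(x)=e^{2\pi i\nu x}f(x)$ and $(T_tf)(x)=f(x-t)$. The inner product $\langle\cdot,\cdot\rangle$ on $L^2(\mathbb R)$ is linear in the first argument. A countable family $\{g_k\}_{k\in I}$ in a separable Hilbert space $\mathcal H$ is a Bessel sequence in $\mathcal H$ if there is $B>0$ with $\sum_{k}|\langle h,g_k\rangle|^2\le B\|h\|^2$ for all $h\in\mathcal H$; it is a frame for $\mathcal H$ if in addition there is $A>0$ with $A\|h\|^2\le\sum_{k}|\langle h,g_k\rangle|^2$ for all $h\in\mathcal H$. A dual frame of a frame $\{g_k\}_{k\in I}$ is a frame $\{f_k\}_{k\in I}$ for $\mathcal H$ with $h=\sum_k\langle h,g_k\rangle f_k=\sum_k\langle h,f_k\rangle g_k$ for all $h\in\mathcal H$. A function $\phi\in L^2(\mathbb R)$ is a dual window of a Gabor frame $\{E_{mb}T_{na}g\}_{m,n\in\mathbb Z}$ if $\{E_{mb}T_{na}\phi\}_{m,n\in\mathbb Z}$ is a dual frame of it (with the same indexing by $(m,n)$). The series over $j$ converge in $L^2(\mathbb R)$. ''Dependent only on $g$, $g^d$ and $a$'' means that $K$ is determined by $g,g^d,a$ and does not depend on $b$, $\phi$ or $w$. *)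

(* Defs.v *)
From HB Require Import structures.
From mathcomp Require Import all_boot all_order all_algebra.
From mathcomp Require Import finmap.
From mathcomp Require Import complex.
From mathcomp Require Import all_classical all_reals all_analysis.
From mathcomp Require Import showcase.summability.

Set Implicit Arguments.
Unset Strict Implicit.
Unset Printing Implicit Defensive.

Import Order.TTheory GRing.Theory Num.Theory.
Import numFieldNormedType.Exports.

Local Open Scope classical_set_scope.
Local Open Scope complex_scope.
Local Open Scope ring_scope.

Section L2.
Context {R : realType}.
Implicit Types f h : R -> R[i].

Local Notation mu := (@lebesgue_measure R).
Local Notation normc := (@ComplexField.Normc.normc R).

(* Elements of L^2(R) are represented by Borel functions; all notions below
   are invariant under almost everywhere equality. *)
Definition L2norm f : \bar R := ('N[mu]_(2%:E)[EFin \o (normc \o f)])%E.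

Definition inL2 f : Prop :=
  [/\ measurable_fun setT (fun x => complex.Re (f x)),
      measurable_fun setT (fun x => complex.Im (f x)) &
      (L2norm f < +oo)%E].

Definition cintegral f : R[i] :=
  (\int[mu]_x complex.Re (f x)) +i* (\int[mu]_x complex.Im (f x)).

Definition L2inner f h : R[i] := cintegral (fun x => f x * (h x)^*%C).

(* The compact set contains the essential support of f. *)
Definition compactly_supported f : Prop :=
  exists2 A : set R, compact A & {ae mu, forall x, ~ A x -> f x = 0}.

(* Unconditional convergence in L^2(R) to h of the series of the u k: the
   finite partial sums converge along the directed set of finite subsets of
   the index set. *)
Definition L2sum_to (I : countType) (u : I -> R -> R[i]) h : Prop :=
  inL2 h /\
  (fun J : {fset I} => L2norm (fun x => h x - \sum_(k <- J) u k x))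
    @ totally --> 0%E.

Definition frame_sum (I : countType) (u : I -> R -> R[i]) h : \bar R :=
  \esum_(k in [set: I]) ((normc (L2inner h (u k))) ^+ 2)%:E.

Definition bessel_sequence (I : countType) (u : I -> R -> R[i]) : Prop :=
  (forall k, inL2 (u k)) /\
  exists2 B : R, 0 < B &
    forall h, inL2 h -> (frame_sum u h <= B%:E * L2norm h ^+ 2)%E.

Definition frame (I : countType) (u : I -> R -> R[i]) : Prop :=
  bessel_sequence u /\
  exists2 A : R, 0 < A &
    forall h, inL2 h -> (A%:E * L2norm h ^+ 2 <= frame_sum u h)%E.

Definition dual_frame (I : countType) (u v : I -> R -> R[i]) : Prop :=
  frame v /\
  forall h, inL2 h ->
    L2sum_to (fun k x => L2inner h (u k) * v k x) h /\
    L2sum_to (fun k x => L2inner h (v k) * u k x) h.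

Definition modulation (nu : R) f : R -> R[i] :=
  fun x => (cos (2 * pi * nu * x) +i* sin (2 * pi * nu * x)) * f x.

Definition translation (t : R) f : R -> R[i] := fun x => f (x - t).

Definition gabor (a b : R) f : int * int -> R -> R[i] :=
  fun mn => modulation (mn.1%:~R * b) (translation (mn.2%:~R * a) f).

Definition dual_window (a b : R) f h : Prop :=
  inL2 h /\ dual_frame (gabor a b f) (gabor a b h).

End L2.

(* Main.v *)
Require Import Defs.
From HB Require Import structures.
From mathcomp Require Import all_boot all_order all_algebra.
From mathcomp Require Import finmap.
From mathcomp Require Import complex.
From mathcomp Require Import all_classical all_reals all_analysis.
From mathcomp Require Import measurable_realfun showcase.summability.
From mathcomp Require Import ring lra zify.

Set Implicit Arguments.
Unset Strict Implicit.
Unset Printing Implicit Defensive.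

Import Order.TTheory GRing.Theory Num.Theory.
Import numFieldNormedType.Exports.

Local Open Scope classical_set_scope.
Local Open Scope complex_scope.
Local Open Scope ring_scope.

(** Write g_p, d_p, w_p and phi_p, with p = (m, n), for the time-frequency
    shifts of the four functions g, g^d, w and phi.  Everything rests on a
    description of the duals of a frame that makes sense in any Hilbert space.

    Let g and d be dual to each other, let w be a Bessel family, and put
    z_p = sum_q <d_p, g_q> w_q and phi_p = d_p + w_p - z_p.  For a vector h let
    y = sum_q <h, w_q> g_q.  Then <h, z_p> = sum_q <h, w_q> <g_q, d_p> = <y, d_p>,
    so that <h, phi_p> = <h - y, d_p> + <h, w_p>, and summing against g_p gives
    (h - y) + y = h.  This is [dual_family_of_bessel]; it also shows that phi is
    Bessel.  The reconstruction with the two families exchanged follows by taking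
    adjoints ([dual_family_sym]), and the lower frame bound of phi follows from the
    reconstruction of h and the Bessel bound of g ([frame_of_synthesis]).
    Conversely, a dual family phi is obtained by choosing w = phi, because z = d
    in that case.

    For Gabor systems the whole family z is generated by its member at p = (0, 0):
    time-frequency shifts are unitary and commute up to a phase, and this phase
    appears once in the vector and once, conjugated, in the coefficient
    ([gabor_synthesis_covariant]).  The double series for z_(0, 0) collapses to
    finitely many values of n, because g^d and the translate of g by n a have
    essentially disjoint supports as soon as |n| a exceeds the sum of their radii
    ([L2inner_gabor_far]); this is the set K, and it only involves g, g^d and a.
    The same finiteness makes phi compactly supported.

    The series exist because a Bessel family can be summed against square summable
    coefficients in a complete space ([bessel_fsum_exists]); completeness of L^2 is
    the Riesz-Fischer theorem ([riesz_fischer]).  Functions are not identified when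
    they agree almost everywhere, so L^2 is a space with a semi-inner product, in
    which limits are unique up to vectors of norm zero.  Estimates are made on
    squared norms, with |x + y|^2 <= 2 |x|^2 + 2 |y|^2 in place of the triangle
    inequality. *)

(** * Squared moduli of complex numbers *)

Section SquaredModulus.
Context {R : realType}.
Implicit Types z c : R[i].

Definition abs2 z : R := complex.Re z ^+ 2 + complex.Im z ^+ 2.

Lemma abs2_ge0 z : 0 <= abs2 z.
Proof. by rewrite addr_ge0 ?sqr_ge0. Qed.

Lemma sqr_normc_abs2 z : ComplexField.Normc.normc z ^+ 2 = abs2 z.
Proof. by case: z => x y; rewrite /= sqr_sqrtr // addr_ge0 ?sqr_ge0. Qed.

Lemma abs2_eq0 z : abs2 z = 0 -> z = 0.
Proof.
case: z => x y /eqP; rewrite /abs2 /= paddr_eq0 ?sqr_ge0 // !sqrf_eq0.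
by case/andP=> /eqP-> /eqP->.
Qed.

Lemma abs2M z c : abs2 (z * c) = abs2 z * abs2 c.
Proof. by case: z c => x y [x' y']; rewrite /abs2 /=; ring. Qed.

Lemma abs2D_le z c : abs2 (z + c) <= 2 * abs2 z + 2 * abs2 c.
Proof.
case: z c => x y [x' y']; rewrite /abs2 /=.
by have := sqr_ge0 (x - x'); have := sqr_ge0 (y - y'); nra.
Qed.

Lemma abs2N z : abs2 (- z) = abs2 z.
Proof. by case: z => x y; rewrite /abs2 /= !sqrrN. Qed.

Lemma abs2_Re z : `|complex.Re z| ^+ 2 <= abs2 z.
Proof. by rewrite real_normK ?num_real // lerDl sqr_ge0. Qed.

Lemma abs2_Im z : `|complex.Im z| ^+ 2 <= abs2 z.
Proof. by rewrite real_normK ?num_real // lerDr sqr_ge0. Qed.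

Lemma ReB z c : complex.Re (z - c) = complex.Re z - complex.Re c.
Proof. by case: z c => ? ? []. Qed.

Lemma ImB z c : complex.Im (z - c) = complex.Im z - complex.Im c.
Proof. by case: z c => ? ? []. Qed.

End SquaredModulus.

(** * Complete semi-inner product spaces *)

(** Positivity is only semi-definite and completeness is that of the seminorm:
    functions that agree almost everywhere remain distinct vectors. *)
HB.mixin Record Lmodule_isSemiHilbert (R : realType) V & GRing.Lmodule R[i] V := {
  ip : V -> V -> R[i];
  ipDl : forall x y z, ip (x + y) z = ip x z + ip y z;
  ipZl : forall c x z, ip (c *: x) z = c * ip x z;
  ipC : forall x y, ip x y = (ip y x)^*;
  ip_ge0 : forall x, 0 <= complex.Re (ip x x);
  ip_complete : forall v : nat -> V,
    (forall e, 0 < e -> exists N, forall m n, (N <= m)%N -> (N <= n)%N ->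
       complex.Re (ip (v m - v n) (v m - v n)) < e) ->
    exists l, forall e, 0 < e -> exists N, forall n, (N <= n)%N ->
       complex.Re (ip (l - v n) (l - v n)) < e
}.

HB.structure Definition SemiHilbert (R : realType) :=
  { V of Lmodule_isSemiHilbert R V & GRing.Lmodule R[i] V }.
Notation semiHilbertType := SemiHilbert.type.

Section Seminorm.
Context {R : realType} {V : semiHilbertType R}.
Implicit Types (x y z : V) (c : R[i]).

Definition sqn x : R := complex.Re (ip x x).

Lemma ipDr x y z : ip z (x + y) = ip z x + ip z y.
Proof. by rewrite ipC ipDl rmorphD /= -!ipC. Qed.

Lemma ipZr c x z : ip z (c *: x) = c^* * ip z x.
Proof. by rewrite ipC ipZl rmorphM /= -ipC. Qed.

Lemma ipNl x z : ip (- x) z = - ip x z.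
Proof. by rewrite -scaleN1r ipZl mulN1r. Qed.

Lemma ipNr x z : ip z (- x) = - ip z x.
Proof. by rewrite ipC ipNl rmorphN /= -ipC. Qed.

Lemma ipBl x y z : ip (x - y) z = ip x z - ip y z.
Proof. by rewrite ipDl ipNl. Qed.

Lemma ipBr x y z : ip z (x - y) = ip z x - ip z y.
Proof. by rewrite ipDr ipNr. Qed.

Lemma ip0l z : ip 0 z = 0.
Proof. by rewrite -(subrr z) ipBl subrr. Qed.

Lemma ip_suml (I : Type) (s : seq I) (F : I -> V) z :
  ip (\sum_(k <- s) F k) z = \sum_(k <- s) ip (F k) z.
Proof.
by elim/big_rec2: _ => [|k a b _ <-]; rewrite ?ip0l // ipDl.
Qed.

Lemma sqn_ge0 x : 0 <= sqn x. Proof. exact: ip_ge0. Qed.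

Lemma Im_ip x : complex.Im (ip x x) = 0.
Proof. by have := ipC x x; case: (ip x x) => a b [] /=; lra. Qed.

Lemma ip_sqn x : ip x x = (sqn x)%:C.
Proof. by rewrite /sqn; have := Im_ip x; case: (ip x x) => a b /= ->. Qed.

Lemma sqn0 : sqn 0 = 0. Proof. by rewrite /sqn ip0l. Qed.

Lemma sqnN x : sqn (- x) = sqn x.
Proof. by rewrite /sqn ipNl ipNr opprK. Qed.

Lemma sqnC x y : sqn (x - y) = sqn (y - x).
Proof. by rewrite -opprB sqnN. Qed.

Lemma sqnZ c x : sqn (c *: x) = abs2 c * sqn x.
Proof.
rewrite /sqn ipZl ipZr ip_sqn /abs2; case: c => a b /=; ring.
Qed.

Lemma sqnD x y : sqn (x + y) = sqn x + sqn y + 2 * complex.Re (ip x y).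
Proof.
rewrite /sqn !ipDl !ipDr [ip y x]ipC.
by case: (ip x x) (ip x y) (ip y y) => [? ?] [? ?] [? ?] /=; ring.
Qed.

Lemma sqnD_le x y : sqn (x + y) <= 2 * sqn x + 2 * sqn y.
Proof.
have := sqnD x (- y); have := sqnD x y; have := sqn_ge0 (x - y).
rewrite sqnN ipNr; case: (ip x y) => a b /=; lra.
Qed.

Lemma sqnB_le x y z : sqn (x - z) <= 2 * sqn (x - y) + 2 * sqn (y - z).
Proof. by rewrite -[x](subrK y) -addrA addrK sqnD_le. Qed.

(** The semi-definite case needs its own argument when [sqn y = 0]: the
    nonnegative quadratic [key] is then affine in [l], hence of slope zero. *)
Lemma cauchy_schwarz x y : abs2 (ip x y) <= sqn x * sqn y.
Proof.
have key (l : R) : 0 <= sqn x - 2 * l * abs2 (ip x y) + l ^+ 2 * abs2 (ip x y) * sqn y.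
  have := sqn_ge0 (x - (l%:C * ip x y) *: y).
  rewrite sqnD sqnN sqnZ ipNr ipZr /abs2; case: (ip x y) => a b /=.
  by congr (_ <= _); ring.
have := sqn_ge0 y; rewrite le_eqVlt => /orP[/eqP y0|y0].
  rewrite -y0 mulr0; rewrite leNgt; apply/negP => A0.
  have := key ((sqn x + 1) / abs2 (ip x y)); rewrite -y0 mulr0 addr0.
  rewrite -mulrA divfK ?gt_eqF //; have := sqn_ge0 x; lra.
have := key (sqn y)^-1.
have -> : sqn x - 2 * (sqn y)^-1 * abs2 (ip x y) +
    (sqn y)^-1 ^+ 2 * abs2 (ip x y) * sqn y = sqn x - abs2 (ip x y) / sqn y.
  by field; rewrite gt_eqF.
by rewrite subr_ge0 ler_pdivrMr.
Qed.

Lemma ip_null x y : sqn x = 0 -> ip x y = 0.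
Proof.
move=> x0; apply: abs2_eq0; apply/eqP; rewrite eq_le abs2_ge0 andbT.
by rewrite (le_trans (cauchy_schwarz _ _)) // x0 mul0r.
Qed.

Lemma sqn_eq0_ip x : (forall y, ip x y = 0) -> sqn x = 0.
Proof. by rewrite /sqn => ->. Qed.

Lemma ip_eqr x y z : sqn (x - y) = 0 -> ip z x = ip z y.
Proof.
by move=> xy0; rewrite ipC [RHS]ipC; congr conjc; apply/eqP;
  rewrite -subr_eq0 -ipBl ip_null.
Qed.

(** By polarization; the imaginary part of the inner product of [x] and [y] is the
    real part of that of [x] and ['i *: y]. *)
Lemma isometry_ip (T : V -> V) : (forall x y, T (x + y) = T x + T y) ->
  (forall c x, T (c *: x) = c *: T x) -> (forall x, sqn (T x) = sqn x) ->
  forall x y, ip (T x) (T y) = ip x y.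
Proof.
move=> TD TZ Tsqn x y.
have TRe u v : complex.Re (ip (T u) (T v)) = complex.Re (ip u v).
  by have := sqnD (T u) (T v); rewrite -TD !Tsqn sqnD; lra.
have := TRe x y; have := TRe x ('i%C *: y); rewrite TZ !ipZr.
case: (ip (T x) (T y)) (ip x y) => p q [p' q'] /= Him ->.
by congr Complex; move: Him; lra.
Qed.

End Seminorm.

(** * Unconditional sums *)

Section UnconditionalSums.
Context {R : realType} {V : semiHilbertType R}.
Implicit Types (I : choiceType) (x y z h : V) (e : R).

(** Convergence along the directed set of finite subsets of [I], which is
    unconditional convergence; the limit is unique up to null vectors. *)
Definition fsum_to I (u : I -> V) h : Prop :=
  forall e, 0 < e -> exists J0 : {fset I}, forall J : {fset I},
    (J0 `<=` J)%fset -> sqn (h - \sum_(k <- J) u k) < e.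

Lemma le0_of_lt_eps (r : R) : (forall e, 0 < e -> r < e) -> r <= 0.
Proof. by move=> h; rewrite leNgt; apply/negP => /h; rewrite ltxx. Qed.

Lemma eq_fsum_to I (u v : I -> V) h : u =1 v -> fsum_to u h -> fsum_to v h.
Proof. by move=> /funext ->. Qed.

Lemma fsum_toD I (u v : I -> V) x y :
  fsum_to u x -> fsum_to v y -> fsum_to (fun k => u k + v k) (x + y).
Proof.
move=> ux vy e e0; have e4 : 0 < e / 4 by rewrite divr_gt0.
have [J1 H1] := ux _ e4; have [J2 H2] := vy _ e4.
exists (J1 `|` J2)%fset => J; rewrite fsubUset => /andP[J1J J2J].
rewrite big_split /= opprD addrACA; apply: le_lt_trans (sqnD_le _ _) _.
by have := H1 J J1J; have := H2 J J2J; lra.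
Qed.

Lemma fsum_to0 I : fsum_to (fun _ : I => 0) 0.
Proof. by move=> e e0; exists fset0 => J _; rewrite big1 // subrr sqn0. Qed.

Lemma fsum_to_seq I (K : eqType) (s : seq K) (u : K -> I -> V) (h : K -> V) :
  (forall k, k \in s -> fsum_to (u k) (h k)) ->
  fsum_to (fun i => \sum_(k <- s) u k i) (\sum_(k <- s) h k).
Proof.
elim: s => [|k s IHs] us.
  rewrite big_nil; apply: (eq_fsum_to (u := fun=> 0)); last exact: fsum_to0.
  by move=> i; rewrite big_nil.
rewrite big_cons.
apply: (eq_fsum_to (u := fun i => u k i + \sum_(k <- s) u k i)) => [i|].
  by rewrite big_cons.
by apply: fsum_toD; [apply: us; rewrite mem_head
  |apply: IHs => k' k's; apply: us; rewrite inE k's orbT].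
Qed.

Lemma fsum_to_isometry I (u : I -> V) h (T : V -> V) :
  (forall x y, T (x + y) = T x + T y) -> (forall x, sqn (T x) = sqn x) ->
  fsum_to u h -> fsum_to (fun k => T (u k)) (T h).
Proof.
move=> TD Tsqn uh e /uh[J0 HJ]; exists J0 => J /HJ.
have T0 : T 0 = 0 by apply: (@addrI _ (T 0)); rewrite -TD !addr0.
have TN x : T (- x) = - T x by apply: (@addrI _ (T x)); rewrite -TD !subrr.
by rewrite -Tsqn TD TN (big_morph T TD T0).
Qed.

(** [g] is a partial inverse of [f], so the finite subsets of [L] pull back to
    finite subsets of [I] along [pmap g].  This covers bijections as well as the
    inclusion of one row into a product. *)
Lemma fsum_to_reindex I (L : choiceType) (f : I -> L) (g : L -> option I) (v : I -> V)
    (u : L -> V) h :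
  pcancel f g -> ocancel g f -> (forall l, u l = oapp v 0 (g l)) ->
  fsum_to v h -> fsum_to u h.
Proof.
move=> fg gf uv vh e /vh[J0 HJ].
exists [fset f i | i in J0]%fset => J /fsubsetP sub.
pose J' : {fset I} := seq_fset tt (pmap g J).
have J'P i : (i \in J') = (f i \in J).
  rewrite seq_fsetE mem_pmap; apply/mapP/idP => [[l lJ il]|fiJ].
    by have := gf l; rewrite -il /= => ->.
  by exists (f i); rewrite ?fg.
have := HJ J'; rewrite (eq_bigr _ (fun l _ => uv l)).
have -> : \sum_(l <- J) oapp v 0 (g l) = \sum_(k <- J') v k.
  rewrite -big_pmap; apply: perm_big; rewrite uniq_perm ?(pmap_uniq gf) //.
  by move=> i; rewrite seq_fsetE.
by apply; apply/fsubsetP => i iJ0; rewrite J'P sub // in_imfset.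
Qed.

Lemma fsum_to_fibers I (L : choiceType) (K : {fset L}) (u : I * L -> V)
    (s : L -> V) :
  (forall k, k \in K -> fsum_to (fun i => u (i, k)) (s k)) ->
  (forall i k, k \notin K -> u (i, k) = 0) ->
  fsum_to u (\sum_(k <- K) s k).
Proof.
move=> us u0.
pose row k (p : I * L) := if p.2 == k then u p else 0.
apply: (eq_fsum_to (u := fun p => \sum_(k <- K) row k p)) => [[i k]|].
  have [kK|kK] := boolP (k \in K).
    rewrite (bigD1_seq k) //= /row eqxx big1 ?addr0 // => k' /negPf.
    by rewrite eq_sym => /= ->.
  rewrite u0 // big_seq big1 // => k' k'K; rewrite /row /=.
  by case: eqP => // kk'; rewrite kk' k'K in kK.
apply: fsum_to_seq => k /us.
apply: (fsum_to_reindex (f := fun i => (i, k))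
  (g := fun p => if p.2 == k then Some p.1 else None)) => [i|[i k']|[i k']] /=.
- by rewrite eqxx.
- by case: eqP => //= ->.
- by rewrite /row /=; case: eqP => //= ->.
Qed.

(** Two sums that look alike termwise have the same inner products, provided the
    series stands on the left in one and on the right in the other: this is how a
    synthesis operator is moved across the inner product. *)
Lemma fsum_to_ip I (u v : I -> V) x y z w :
  fsum_to u x -> fsum_to v y ->
  (forall k, ip (u k) z = ip w (v k)) -> ip x z = ip w y.
Proof.
move=> ux vy uv; apply/eqP; rewrite -subr_eq0.
apply/eqP/abs2_eq0/eqP; rewrite eq_le abs2_ge0 andbT; apply: le0_of_lt_eps => e e0.
pose M := 2 * sqn z + 2 * sqn w + 1.
have M0 : 0 < M by have := sqn_ge0 z; have := sqn_ge0 w; rewrite /M; lra.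
have [J1 H1] := ux _ (divr_gt0 e0 M0); have [J2 H2] := vy _ (divr_gt0 e0 M0).
pose J := (J1 `|` J2)%fset.
have {}H1 := H1 J (fsubsetUl _ _); have {}H2 := H2 J (fsubsetUr _ _).
have S : ip (\sum_(k <- J) u k) z = ip w (\sum_(k <- J) v k).
  rewrite ip_suml [RHS]ipC ip_suml rmorph_sum /=.
  by apply: eq_bigr => k _; rewrite uv -ipC.
have -> : ip x z - ip w y =
    ip (x - \sum_(k <- J) u k) z - ip w (y - \sum_(k <- J) v k).
  by rewrite ipBl ipBr S; ring.
apply: le_lt_trans (abs2D_le _ _) _; rewrite abs2N.
move: H1 H2; set a := sqn (x - _); set b := sqn (y - _) => H1 H2.
have C1 := cauchy_schwarz (x - \sum_(k <- J) u k) z.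
have C2 := cauchy_schwarz w (y - \sum_(k <- J) v k).
rewrite -/a in C1; rewrite -/b in C2.
have z0 := sqn_ge0 z; have w0 := sqn_ge0 w.
set t := e / M in H1 H2.
have tM : t * M = e by rewrite divfK // gt_eqF.
have t0 : 0 < t by rewrite divr_gt0.
have L1 : a * sqn z <= t * sqn z by rewrite ler_wpM2r // ltW.
have L2 : sqn w * b <= t * sqn w by rewrite mulrC ler_wpM2r // ltW.
by rewrite -tM /M; lra.
Qed.

Lemma fsum_to_unique I (u : I -> V) x y :
  fsum_to u x -> fsum_to u y -> sqn (x - y) = 0.
Proof.
move=> ux uy; apply/eqP; rewrite eq_le sqn_ge0 andbT; apply: le0_of_lt_eps => e e0.
have e4 : 0 < e / 4 by rewrite divr_gt0.
have [J1 H1] := ux _ e4; have [J2 H2] := uy _ e4.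
have {}H1 := H1 (J1 `|` J2)%fset (fsubsetUl _ _).
have {}H2 := H2 (J1 `|` J2)%fset (fsubsetUr _ _).
apply: le_lt_trans (sqnB_le _ (\sum_(k <- (J1 `|` J2)%fset) u k) _) _.
by rewrite [in X in _ + _ * X]sqnC; lra.
Qed.

Lemma fsum_to_eqr I (u : I -> V) x y :
  sqn (x - y) = 0 -> fsum_to u x -> fsum_to u y.
Proof.
move=> xy0 ux e e0; have [J0 H] := ux _ (divr_gt0 e0 (ltr0Sn _ 1)).
exists J0 => J /H HJ; apply: le_lt_trans (sqnB_le _ x _) _.
by rewrite sqnC xy0; lra.
Qed.

End UnconditionalSums.

(** * Bessel sequences *)

Section BesselSequences.
Context {R : realType} {V : semiHilbertType R} {I : choiceType}.
Implicit Types (B M e : R) (x y z h : V) (u : I -> V) (c : I -> R[i]).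

(** The bound on finite sums is the bound on the sum of the whole series, since
    all terms are nonnegative. *)
Definition bessel (B : R) u : Prop := forall h (J : {fset I}),
  \sum_(k <- J) abs2 (ip h (u k)) <= B * sqn h.

(** Synthesis has the same bound as analysis, of which it is the adjoint.  For
    [v] the sum, |v|^2 = Re sum_k c_k <u_k, v>, and each term is bounded by
    B/2 |c_k|^2 + 1/(2B) |<v, u_k>|^2; the Bessel bound for [v] absorbs the second
    half into |v|^2 / 2. *)
Lemma bessel_synthesis B u c (J : {fset I}) : 0 < B -> bessel B u ->
  sqn (\sum_(k <- J) c k *: u k) <= B * \sum_(k <- J) abs2 (c k).
Proof.
move=> B0 uB; set v := \sum_(k <- J) _.
have {}uB := uB v J.
have : sqn v <= \sum_(k <- J) (B / 2 * abs2 (c k) + (2 * B)^-1 * abs2 (ip v (u k))).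
  rewrite {1}/sqn {1}/v ip_suml.
  rewrite (big_morph (@complex.Re R) (id1 := 0) (op1 := +%R)) //; last first.
    by move=> [? ?] [? ?].
  apply: ler_sum => k _; rewrite ipZl [ip (u k) v]ipC.
  case: (c k) (ip v (u k)) => a b [a' b']; rewrite /abs2 /=.
  set X := _ * (a' ^+ 2 + _).
  have -> : X = B / 2 * ((a' / B) ^+ 2 + (b' / B) ^+ 2).
    by rewrite /X; field; rewrite gt_eqF.
  have E t : t = B * (t / B) by rewrite mulrC divfK // gt_eqF.
  rewrite [in leLHS](E a') [in leLHS](E b'); set p := a' / B; set q := b' / B.
  rewrite -subr_ge0; have : 0 <= B / 2 * ((a - p) ^+ 2 + (b - q) ^+ 2).
    by rewrite mulr_ge0 ?addr_ge0 ?sqr_ge0 // divr_ge0 // ltW.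
  by congr (_ <= _); field.
rewrite big_split /= -!mulr_sumr => H.
have : (2 * B)^-1 * \sum_(k <- J) abs2 (ip v (u k)) <= (2 * B)^-1 * (B * sqn v).
  by rewrite ler_wpM2l // invr_ge0; lra.
have -> : (2 * B)^-1 * (B * sqn v) = sqn v / 2 by field; rewrite gt_eqF.
lra.
Qed.

(** The constant [2] comes from [sqnD_le] and could be lowered to [1]; only the
    existence of a bound matters for frames. *)
Lemma sqn_fsum_le B u c M y : 0 < B -> bessel B u ->
  (forall J : {fset I}, \sum_(k <- J) abs2 (c k) <= M) ->
  fsum_to (fun k => c k *: u k) y -> sqn y <= 2 * (B * M).
Proof.
move=> B0 uB cM uy; rewrite -subr_le0; apply: le0_of_lt_eps => e e0.
have [J H] := uy _ (divr_gt0 e0 (ltr0Sn _ 1)).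
have {}H := H J (fsubset_refl _).
have := bessel_synthesis c J B0 uB.
have : B * \sum_(k <- J) abs2 (c k) <= B * M by rewrite ler_wpM2l // ltW.
have := sqnD_le (y - \sum_(k <- J) c k *: u k) (\sum_(k <- J) c k *: u k).
by rewrite subrK; lra.
Qed.

(** Finite sets that almost exhaust the supremum of the sums of |c_k|^2 leave
    little room outside, so by [bessel_synthesis] the partial sums over them form a
    Cauchy sequence; its limit is the limit of the whole net. *)
Lemma bessel_fsum_exists B u c M : 0 < B -> bessel B u ->
  (forall J : {fset I}, \sum_(k <- J) abs2 (c k) <= M) ->
  exists y, fsum_to (fun k => c k *: u k) y.
Proof.
move=> B0 uB cM.
pose N (J : {fset I}) := \sum_(k <- J) abs2 (c k).
pose A := range N.
have Asup : has_sup A.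
  by split; [exists (N fset0), fset0|exists M => _ [J _ <-]; apply: cM].
have tail e : 0 < e -> exists J0 : {fset I}, forall J : {fset I},
    (J0 `<=` J)%fset ->
    sqn (\sum_(k <- J) c k *: u k - \sum_(k <- J0) c k *: u k) <= B * e.
  move=> e0; have [_ [J0 _ <-] HJ0] := sup_adherent e0 Asup.
  exists J0 => J J0J.
  have NJ : N J <= sup A by apply: ub_le_sup; [case: Asup|exists J].
  have split_sum (W : nmodType) (F : I -> W) :
      \sum_(k <- J) F k = \sum_(k <- (J `\` J0)%fset) F k + \sum_(k <- J0) F k.
    rewrite -big_cat /=; apply: perm_big; apply: uniq_perm => //=.
      rewrite cat_uniq !fset_uniq andbT /=; apply/hasPn => k kJ0.
      by rewrite inE kJ0.
    move=> k; rewrite mem_cat inE orbC; case: (boolP (k \in J0)) => //= kJ0.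
    by rewrite (fsubsetP J0J).
  rewrite split_sum addrK; apply: le_trans (bessel_synthesis _ _ B0 uB) _.
  rewrite ler_wpM2l ?(ltW B0) //.
  by move: NJ HJ0; rewrite /N split_sum; lra.
have /choice[f fP] : forall n, exists J0 : {fset I}, forall J : {fset I},
    (J0 `<=` J)%fset ->
    sqn (\sum_(k <- J) c k *: u k - \sum_(k <- J0) c k *: u k) <= B * n.+1%:R^-1.
  by move=> n; apply: tail; rewrite invr_gt0.
pose v n := \sum_(k <- f n) c k *: u k.
have small e : 0 < e -> exists n0, forall n, (n0 <= n)%N -> B * n.+1%:R^-1 < e.
  move=> e0; have [n0 _ n0P] := near_infty_natSinv_lt (PosNum (divr_gt0 e0 B0)).
  by exists n0 => n /n0P /=; rewrite ltr_pdivlMr // mulrC.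
have cauchy e : 0 < e -> exists N, forall m n, (N <= m)%N -> (N <= n)%N ->
    complex.Re (ip (v m - v n) (v m - v n)) < e.
  move=> e0; have [n0 Hn0] := small _ (divr_gt0 e0 (ltr0Sn _ 3)).
  exists n0 => m n /Hn0 Hm /Hn0 Hn; rewrite -/(sqn _).
  have Fm := fP m _ (fsubsetUl (f m) (f n)).
  have Fn := fP n _ (fsubsetUr (f m) (f n)).
  apply: le_lt_trans (sqnB_le _ (\sum_(k <- (f m `|` f n)%fset) c k *: u k) _) _.
  rewrite sqnC.
  have {}Fm := le_lt_trans Fm Hm; have {}Fn := le_lt_trans Fn Hn.
  by move: Fm Fn; rewrite /v; lra.
have [y yP] := ip_complete v cauchy.
exists y => e e0; have e4 : 0 < e / 4 by rewrite divr_gt0.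
have [n1 H1] := yP _ e4; have [n2 H2] := small _ e4.
pose n := maxn n1 n2; exists (f n) => J fJ.
have {}H1 := H1 n (leq_maxl _ _); have {}H2 := H2 n (leq_maxr _ _).
apply: le_lt_trans (sqnB_le _ (v n) _) _.
rewrite [in X in _ + _ * X]sqnC; have {H2} := le_lt_trans (fP n J fJ) H2.
by move: H1; rewrite -/(sqn _) -/(v n); lra.
Qed.

End BesselSequences.

Lemma bessel_reindex {R : realType} {V : semiHilbertType R} (I L : choiceType)
    (B : R) (u : L -> V) (f : I -> L) :
  injective f -> bessel B u -> bessel B (fun i => u (f i)).
Proof.
move=> finj uB h J; apply: le_trans (uB h [fset f i | i in J]%fset).
by rewrite big_imfset //= => i j _ _; apply: finj.
Qed.

(** * The duals of a frame *)

Section DualFamilies.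
Context {R : realType} {V : semiHilbertType R} {I : choiceType}.
Implicit Types (x y h : V) (g gd w z phi : I -> V).

(** The vector [y] of [key] is sum_j <h, w_j> g_j, so that <h, z_k> = <y, gd_k>:
    subtracting [z] from [gd + w] amounts to correcting [h] to [h - y] before the
    analysis with [gd], and [w] puts [y] back. *)
Lemma dual_family_of_bessel (Bg Bd Bw : R) g gd w z phi :
  0 < Bg -> bessel Bg g -> 0 < Bd -> bessel Bd gd -> 0 < Bw -> bessel Bw w ->
  (forall h, fsum_to (fun k => ip h (gd k) *: g k) h) ->
  (forall k, fsum_to (fun j => ip (gd k) (g j) *: w j) (z k)) ->
  (forall k, sqn (phi k - (gd k + w k - z k)) = 0) ->
  (exists2 B, 0 < B & bessel B phi) /\
  (forall h, fsum_to (fun k => ip h (phi k) *: g k) h).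
Proof.
move=> Bg0 gB Bd0 gdB Bw0 wB gdual zP phiP.
have key h : exists2 y, sqn y <= 2 * (Bg * (Bw * sqn h)) &
    fsum_to (fun k => ip h (w k) *: g k) y /\
    forall k, ip h (phi k) = ip (h - y) (gd k) + ip h (w k).
  have [y yP] := bessel_fsum_exists Bg0 gB (wB h).
  exists y; first exact: sqn_fsum_le Bg0 gB (wB h) yP.
  split=> // k; rewrite (ip_eqr _ (phiP k)) ipBr ipDr ipBl.
  suff -> : ip h (z k) = ip y (gd k) by ring.
  apply/esym/(fsum_to_ip yP (zP k)) => j.
  by rewrite ipZl ipZr -ipC mulrC.
split.
  exists (4 * Bd * (1 + 2 * Bg * Bw) + 2 * Bw).
    by rewrite addr_gt0 ?mulr_gt0 ?addr_gt0 ?mulr_gt0.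
  move=> h J; have [y yh [_ hphi]] := key h.
  have : \sum_(k <- J) abs2 (ip h (phi k)) <=
      \sum_(k <- J) (2 * abs2 (ip (h - y) (gd k)) + 2 * abs2 (ip h (w k))).
    by apply: ler_sum => k _; rewrite hphi abs2D_le.
  rewrite [X in _ <= X -> _]big_split /= -!mulr_sumr.
  have := gdB (h - y) J; have := wB h J.
  have : Bd * sqn (h - y) <= Bd * (2 * sqn h + 2 * (2 * (Bg * (Bw * sqn h)))).
    rewrite ler_wpM2l ?(ltW Bd0) //.
    by have := sqnD_le h (- y); rewrite sqnN; lra.
  nra.
move=> h; have [y _ [yP hphi]] := key h.
have := fsum_toD (gdual (h - y)) yP; rewrite subrK.
by apply: eq_fsum_to => k; rewrite -scalerDl hphi.
Qed.

(** The adjoint of the identity is the identity: the sum [y] of the exchanged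
    series satisfies <y, x> = <h, x> for every [x]. *)
Lemma dual_family_sym (Bg Bphi : R) g phi :
  bessel Bg g -> 0 < Bphi -> bessel Bphi phi ->
  (forall h, fsum_to (fun k => ip h (phi k) *: g k) h) ->
  forall h, fsum_to (fun k => ip h (g k) *: phi k) h.
Proof.
move=> gB B0 phiB dual h.
have [y yP] := bessel_fsum_exists B0 phiB (gB h).
apply: (fsum_to_eqr _ yP); apply: sqn_eq0_ip => x.
rewrite ipBl (_ : ip y x = ip h x) ?subrr //.
apply: (fsum_to_ip yP (dual x)) => k.
by rewrite ipZl ipZr -ipC mulrC.
Qed.

End DualFamilies.

(** * Square-integrable functions *)

Section SquareIntegrable.
Context {R : realType}.
Implicit Types (f h : R -> R[i]) (u v : R -> R).
Local Notation mu := (@lebesgue_measure R).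

Definition cmeasurable f := measurable_fun setT (fun x => complex.Re (f x)) /\
  measurable_fun setT (fun x => complex.Im (f x)).

(** The semiring of sets that [almost_everywhere] carries here is only convertible
    to the one of [ae_filter_ringOfSetsType], and instance resolution misses it. *)
Lemma ae_lebesgue_filter : Filter (almost_everywhere mu).
Proof. exact: (ae_filter_ringOfSetsType (@lebesgue_measure R)). Qed.

Lemma ae_impl (P Q : R -> Prop) : (forall x, P x -> Q x) ->
  {ae mu, forall x, P x} -> {ae mu, forall x, Q x}.
Proof. exact: (@filterS _ _ ae_lebesgue_filter). Qed.

Lemma ae_and (P Q : R -> Prop) : {ae mu, forall x, P x} ->
  {ae mu, forall x, Q x} -> {ae mu, forall x, P x /\ Q x}.
Proof. exact: (@filterI _ _ ae_lebesgue_filter). Qed.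

Lemma L2norm_sqr f : (L2norm f ^+ 2 = \int[mu]_x (abs2 (f x))%:E)%E.
Proof.
rewrite /L2norm unlock; have int_ge0 : (0 <= \int[mu]_x (abs2 (f x))%:E)%E.
  by apply: integral_ge0 => x _; rewrite lee_fin abs2_ge0.
rewrite -[RHS]sqr_sqrte // -poweR12_sqrt //; congr ((_ `^ _) ^+ 2)%E.
apply: eq_integral => x _ /=; rewrite powR_mulrn ?normr_ge0 //.
by rewrite real_normK ?num_real // sqr_normc_abs2.
Qed.

Lemma L2norm_ge0 f : (0 <= L2norm f)%E.
Proof. exact: Lnorm_ge0. Qed.

Lemma L2norm_lty f : ((L2norm f < +oo) = (\int[mu]_x (abs2 (f x))%:E < +oo))%E.
Proof.
rewrite -L2norm_sqr; have := L2norm_ge0 f.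
by case: (L2norm f) => [r||] //= _; rewrite ?ltry // expe2 mulyy.
Qed.

Lemma measurable_abs2 f : cmeasurable f ->
  measurable_fun setT (fun x => abs2 (f x)).
Proof.
by case=> mr mi; apply: measurable_funD; apply: measurable_funX.
Qed.

Lemma inL2P f : inL2 f <->
  cmeasurable f /\ mu.-integrable setT (EFin \o (fun x => abs2 (f x))).
Proof.
have E : (\int[mu]_x `|(EFin \o (fun x => abs2 (f x))) x| =
          \int[mu]_x (abs2 (f x))%:E)%E.
  by apply: eq_integral => x _ /=; rewrite ger0_norm ?abs2_ge0.
split=> [[mr mi foo]|[[mr mi] /integrableP[_ foo]]].
  split=> //; apply/integrableP; split; last by rewrite E -L2norm_lty.
  by apply/measurable_EFinP; apply: measurable_abs2.
by split=> //; rewrite L2norm_lty -E.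
Qed.

Lemma inL2_cmeasurable f : inL2 f -> cmeasurable f.
Proof. by case. Qed.

Lemma dominated_integrable u v : measurable_fun setT u ->
  (forall x, `|u x| <= v x) -> mu.-integrable setT (EFin \o v) ->
  mu.-integrable setT (EFin \o u).
Proof.
move=> mu_ uv; apply: le_integrable => //; first exact/measurable_EFinP.
by move=> x _ /=; rewrite lee_fin (le_trans (uv x)) ?ler_norm.
Qed.

Lemma integrable_scale r u : mu.-integrable setT (EFin \o u) ->
  mu.-integrable setT (EFin \o (fun x => r * u x)).
Proof. by move=> /(integrableZl measurableT r). Qed.

Lemma integrable_add u v : mu.-integrable setT (EFin \o u) ->
  mu.-integrable setT (EFin \o v) ->
  mu.-integrable setT (EFin \o (fun x => u x + v x)).
Proof. by move=> /(integrableD measurableT) + jv => /(_ _ jv). Qed.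

Lemma dominated_inL2 f h c : cmeasurable f -> inL2 h ->
  (forall x, abs2 (f x) <= c * abs2 (h x)) -> inL2 f.
Proof.
move=> mf /inL2P[mh ih] fh; apply/inL2P; split=> //.
apply: (dominated_integrable (v := fun x => c * abs2 (h x))).
- exact: measurable_abs2.
- by move=> x; rewrite ger0_norm ?abs2_ge0.
- exact: integrable_scale.
Qed.

Lemma cmeasurableD f h : cmeasurable f -> cmeasurable h ->
  cmeasurable (fun x => f x + h x).
Proof.
move=> [mf nf] [mh nh]; split.
  apply: (eq_measurable_fun (fun x => complex.Re (f x) + complex.Re (h x))).
    by move=> x _; case: (f x) (h x) => ? ? [].
  exact: measurable_funD.
apply: (eq_measurable_fun (fun x => complex.Im (f x) + complex.Im (h x))).
  by move=> x _; case: (f x) (h x) => ? ? [].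
exact: measurable_funD.
Qed.

Lemma cmeasurableM f h : cmeasurable f -> cmeasurable h ->
  cmeasurable (fun x => f x * h x).
Proof.
move=> [mf nf] [mh nh]; split.
  apply: (eq_measurable_fun (fun x => complex.Re (f x) * complex.Re (h x)
                                    - complex.Im (f x) * complex.Im (h x))).
    by move=> x _; case: (f x) (h x) => ? ? [].
  by apply: measurable_funB; apply: measurable_funM.
apply: (eq_measurable_fun (fun x => complex.Re (f x) * complex.Im (h x)
                                  + complex.Im (f x) * complex.Re (h x))).
  by move=> x _; case: (f x) (h x) => ? ? [].
by apply: measurable_funD; apply: measurable_funM.
Qed.

Lemma cmeasurable_conj f : cmeasurable f -> cmeasurable (fun x => (f x)^*).
Proof.
move=> [mf nf]; split.
  by apply: eq_measurable_fun mf => x _; case: (f x).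
apply: (eq_measurable_fun (fun x => - complex.Im (f x))).
  by move=> x _; case: (f x).
exact: measurableT_comp.
Qed.

Lemma cmeasurable_cst c : cmeasurable (fun _ => c).
Proof. by split; apply: measurable_cst. Qed.

Lemma cmeasurableB f h : cmeasurable f -> cmeasurable h ->
  cmeasurable (fun x => f x - h x).
Proof.
move=> mf mh; have -> : (fun x => f x - h x) = (fun x => f x + (-1) * h x).
  by apply/funext => x; rewrite mulN1r.
by apply: cmeasurableD => //; apply: cmeasurableM => //; apply: cmeasurable_cst.
Qed.

Lemma inL20 : inL2 (fun _ : R => 0).
Proof.
apply/inL2P; split; first exact: cmeasurable_cst.
apply: (dominated_integrable (v := fun=> 0)) => [|x|]; last exact: integrable0.
  by apply: measurable_abs2; apply: cmeasurable_cst.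
by rewrite /abs2 /= expr0n addr0 normr0.
Qed.

Lemma inL2D f h : inL2 f -> inL2 h -> inL2 (fun x => f x + h x).
Proof.
move=> /inL2P[mf jf] /inL2P[mh jh].
have mfh := cmeasurableD mf mh; apply/inL2P; split=> //.
apply: (dominated_integrable (v := fun x => 2 * abs2 (f x) + 2 * abs2 (h x))).
- exact: measurable_abs2.
- by move=> x; rewrite ger0_norm ?abs2_ge0 // abs2D_le.
- by apply: integrable_add; apply: integrable_scale.
Qed.

Lemma inL2Z c f : inL2 f -> inL2 (fun x => c * f x).
Proof.
move=> f2; apply: (dominated_inL2 (c := abs2 c) _ f2) => [|x].
  apply: cmeasurableM (inL2_cmeasurable f2); exact: cmeasurable_cst.
by rewrite abs2M.
Qed.

(** Both parts of f h^* are dominated by |f|^2 + |h|^2. *)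
Lemma inner_integrable f h : inL2 f -> inL2 h ->
  mu.-integrable setT (EFin \o (fun x => complex.Re (f x * (h x)^*))) /\
  mu.-integrable setT (EFin \o (fun x => complex.Im (f x * (h x)^*))).
Proof.
move=> /inL2P[mf jf] /inL2P[mh jh].
have [mr mi] := cmeasurableM mf (cmeasurable_conj mh).
have jfh : mu.-integrable setT (EFin \o (fun x => abs2 (f x) + abs2 (h x))).
  exact: integrable_add.
split; apply: dominated_integrable jfh => // x.
  case: (f x) (h x) => a b [a' b'] /=; rewrite /abs2 /= ler_norml; apply/andP.
  by split; have := sqr_ge0 (a - a'); have := sqr_ge0 (b - b');
    have := sqr_ge0 (a + a'); have := sqr_ge0 (b + b'); nra.
case: (f x) (h x) => a b [a' b'] /=; rewrite /abs2 /= ler_norml; apply/andP.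
by split; have := sqr_ge0 (a - b'); have := sqr_ge0 (b - a');
  have := sqr_ge0 (a + b'); have := sqr_ge0 (b + a'); nra.
Qed.

Lemma L2innerDl f1 f2 h : inL2 f1 -> inL2 f2 -> inL2 h ->
  L2inner (fun x => f1 x + f2 x) h = L2inner f1 h + L2inner f2 h.
Proof.
move=> L1 L2 Lh; have [r1 i1] := inner_integrable L1 Lh.
have [r2 i2] := inner_integrable L2 Lh.
rewrite /L2inner /cintegral; congr Complex; rewrite -RintegralD //;
  apply: eq_Rintegral => x _.
  by case: (f1 x) (f2 x) (h x) => ? ? [? ?] [? ?] /=; ring.
by case: (f1 x) (f2 x) (h x) => ? ? [? ?] [? ?] /=; ring.
Qed.

Lemma L2innerZl c f h : inL2 f -> inL2 h ->
  L2inner (fun x => c * f x) h = c * L2inner f h.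
Proof.
move=> Lf Lh; have [jr ji] := inner_integrable Lf Lh.
case: c => a b; rewrite /L2inner /cintegral; congr Complex.
  rewrite -!RintegralZl // -RintegralB //; try exact: integrable_scale.
  by apply: eq_Rintegral => x _; case: (f x) (h x) => ? ? [? ?] /=; ring.
rewrite -!RintegralZl // -RintegralD //; try exact: integrable_scale.
by apply: eq_Rintegral => x _; case: (f x) (h x) => ? ? [? ?] /=; ring.
Qed.

Lemma L2innerC f h : inL2 f -> inL2 h -> L2inner f h = (L2inner h f)^*.
Proof.
move=> Lf Lh; have [jr ji] := inner_integrable Lh Lf.
rewrite /L2inner /cintegral /=; congr Complex.
  by apply: eq_Rintegral => x _; case: (f x) (h x) => ? ? [? ?] /=; ring.
rewrite -mulN1r -RintegralZl //.
by apply: eq_Rintegral => x _; case: (f x) (h x) => ? ? [? ?] /=; ring.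
Qed.

Lemma Re_L2inner f : complex.Re (L2inner f f) = \int[mu]_x abs2 (f x).
Proof.
by apply: eq_Rintegral => x _; case: (f x) => a b; rewrite /abs2 /=; ring.
Qed.

Lemma L2norm_sqr_fin f : inL2 f -> (L2norm f ^+ 2)%E = (complex.Re (L2inner f f))%:E.
Proof.
move=> /inL2P[mf jf]; rewrite L2norm_sqr Re_L2inner /Rintegral fineK //.
exact: integrable_fin_num jf.
Qed.

Lemma L2norm_eq0_ae f : inL2 f -> complex.Re (L2inner f f) = 0 ->
  {ae mu, forall x, f x = 0}.
Proof.
move=> Lf f0; have /inL2P[mf jf] := Lf.
have : (\int[mu]_x `|(EFin \o (fun x => abs2 (f x))) x| = 0)%E.
  rewrite -[RHS]/(0%:E) -f0 -L2norm_sqr_fin // L2norm_sqr.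
  by apply: eq_integral => x _ /=; rewrite ger0_norm ?abs2_ge0.
move/ae_eq_integral_abs => /(_ measurableT).
have mE : measurable_fun setT (EFin \o (fun x => abs2 (f x))).
  by apply/measurable_EFinP; apply: measurable_abs2.
by move=> /(_ mE); apply: filterS => x /(_ I) [] /abs2_eq0.
Qed.

Lemma L2inner_ae0 f h : inL2 f -> inL2 h ->
  {ae mu, forall x, f x * (h x)^* = 0} -> L2inner f h = 0.
Proof.
move=> Lf Lh fh0; have [/integrableP[mr _] /integrableP[mi _]] := inner_integrable Lf Lh.
rewrite /L2inner /cintegral; congr Complex; rewrite /Rintegral.
  rewrite (ae_eq_integral (cst 0%E)) ?integral0 //.
  by apply: ae_impl fh0 => x /= -> _.
rewrite (ae_eq_integral (cst 0%E)) ?integral0 //.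
by apply: ae_impl fh0 => x /= -> _.
Qed.

End SquareIntegrable.

(** * Completeness of the space of square-integrable functions *)

Section RieszFischer.
Context {R : realType}.
Implicit Types (f l : R -> R[i]) (e : R).
Local Notation mu := (@lebesgue_measure R).

Lemma geometric_steps_cvg (u : nat -> R) (C : R) : 0 <= C ->
  (forall n, `|u n.+1 - u n| <= C * 2^-1 ^+ n) -> cvgn u.
Proof.
move=> C0 uC; have -> : u = (fun n => u 0%N + series (telescope u) n).
  by apply/funext => n; exact: eq_sum_telescope.
apply: is_cvgD; first exact: is_cvg_cst.
apply: normed_cvg.
have half : `|2^-1 : R| < 1 by rewrite ger0_norm ?invf_lt1 ?invr_ge0 ?ltr1n.
apply: (series_le_cvg (v_ := geometric C 2^-1)) => [n|n|n|] /=.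
- by [].
- by rewrite mulr_ge0 // exprn_ge0 // invr_ge0.
- exact: uC.
- exact: is_cvg_geometric_series.
Qed.

(** Convergence only holds almost everywhere, so the function [l] is compared with
    the lower limit of the integrands before the lemma of Fatou applies to the latter. *)
Lemma fatou_abs2 (u : nat -> R -> R[i]) l e :
  (forall n, cmeasurable (u n)) -> cmeasurable l ->
  {ae mu, forall x, (complex.Re (u n x) @[n --> \oo] --> complex.Re (l x)) /\
                    (complex.Im (u n x) @[n --> \oo] --> complex.Im (l x))} ->
  (forall n, (\int[mu]_x (abs2 (u n x))%:E <= e%:E)%E) ->
  (\int[mu]_x (abs2 (l x))%:E <= e%:E)%E.
Proof.
move=> mu_ ml ul ue.
pose F n x := (abs2 (u n x))%:E.
have mF n : measurable_fun setT (F n).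
  by apply/measurable_EFinP; apply: measurable_abs2.
have F0 n x : (0 <= F n x)%E by rewrite lee_fin abs2_ge0.
have Fl : {ae mu, forall x, setT x -> (abs2 (l x))%:E = limn_einf (F^~ x)}.
  apply: ae_impl ul => x [ur ui] _; apply/esym.
  suff /cvg_limn_einf_sup[-> _] : F^~ x @ \oo --> (abs2 (l x))%:E by [].
  apply/fine_cvgP; split; first exact: nearW.
  exact: (cvgD (cvgM ur ur) (cvgM ui ui)).
rewrite (@ge0_ae_eq_integral _ _ _ (@lebesgue_measure R) setT
  (fun x => (abs2 (l x))%:E) (fun x => limn_einf (F^~ x))) //; last first.
- by move=> x _; rewrite limn_einf_lim; apply: lime_ge;
    [exact: is_cvg_einfs|apply: nearW => n; apply: le_ereal_inf_tmp => _ [m _ <-]].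
- by move=> x _; rewrite lee_fin abs2_ge0.
- rewrite /limn_einf; apply: measurableT_comp => //.
  by apply: measurable_fun_limn_esup => n; apply/measurable_EFinP;
    apply: measurableT_comp => //; apply: measurable_abs2.
- by apply/measurable_EFinP; apply: measurable_abs2.
have /le_trans := @fatou _ _ _ (@lebesgue_measure R) _ measurableT _ mF
  (fun n x _ => F0 n x).
apply.
rewrite limn_einf_lim; apply: lime_le; first exact: is_cvg_einfs.
apply: nearW => n; apply: le_trans (ue n).
by apply: ereal_inf_lbound; exists n => /=.
Qed.

(** With D_n = |w_(n+1) - w_n|^2 the series of the 4^n D_n has a finite integral,
    at most the sum of the 4^n 8^-n.  Its sum [T] is therefore finite almost
    everywhere, and there D_n <= T 4^-n: consecutive terms differ by at most
    (sqrt T) 2^-n, which forces convergence. *)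
Lemma fast_cauchy_ae_cvg (w : nat -> R -> R[i]) : (forall n, cmeasurable (w n)) ->
  (forall n, (\int[mu]_x (abs2 (w n.+1 x - w n x))%:E <= (8^-1 ^+ n)%:E)%E) ->
  exists2 l, cmeasurable l &
    {ae mu, forall x, (complex.Re (w n x) @[n --> \oo] --> complex.Re (l x)) /\
                      (complex.Im (w n x) @[n --> \oo] --> complex.Im (l x))}.
Proof.
move=> mw wfast; pose D n x := abs2 (w n.+1 x - w n x).
have mD n : measurable_fun setT (D n).
  by apply: measurable_abs2; apply: cmeasurableB.
pose T x := (\sum_(n <oo) (4 ^+ n * D n x)%:E)%E.
have T0 n x : (0 <= (4 ^+ n * D n x)%:E)%E.
  by rewrite lee_fin mulr_ge0 ?exprn_ge0 ?abs2_ge0.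
have mTn n : measurable_fun setT (fun x => (4 ^+ n * D n x)%:E).
  by apply/measurable_EFinP; apply: measurable_funM.
have mT : measurable_fun setT T by apply: ge0_emeasurable_sum.
have intT : (\int[mu]_x T x <= 2%:E)%E.
  rewrite integral_nneseries //.
  apply: lime_le; first by apply: is_cvg_nneseries => n _ _; apply: integral_ge0.
  apply: nearW => n; apply: (@le_trans _ _ (\sum_(0 <= i < n) (2^-1 ^+ i)%:E)%E).
    apply: lee_sum => i _.
    have -> : (\int[mu]_x (4 ^+ i * D i x)%:E = (4 ^+ i)%:E * \int[mu]_x (D i x)%:E)%E.
      under eq_integral do rewrite EFinM.
      rewrite ge0_integralZl_EFin ?exprn_ge0 //; first by move=> x _; rewrite lee_fin abs2_ge0.
      by apply/measurable_EFinP; apply: mD.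
    apply: (@le_trans _ _ ((4 ^+ i)%:E * (8^-1 ^+ i)%:E)%E).
      by rewrite lee_wpmul2l ?wfast // lee_fin exprn_ge0.
    by rewrite -EFinM lee_fin -exprMn (_ : 4 * 8^-1 = 2^-1 :> R) //; field.
  rewrite sumEFin lee_fin.
  have -> : \sum_(0 <= i < n) 2^-1 ^+ i = 2 - 2 * 2^-1 ^+ n :> R.
    elim: n => [|n IH]; first by rewrite big_nil expr0; ring.
    by rewrite big_nat_recr //= IH exprS; field.
  by rewrite gerBl mulr_ge0 // exprn_ge0 // invr_ge0.
pose S := [set x | T x \is a fin_num].
have mS : measurable S by rewrite -[S]setTI; apply: emeasurable_fin_num.
have aeS : {ae mu, forall x, S x}.
  have /(integrable_ae measurableT) : mu.-integrable setT T.
    apply/integrableP; split=> //; apply: le_lt_trans (ltry 2).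
    apply: le_trans intT; rewrite le_eqVlt; apply/orP; left; apply/eqP.
    by apply: eq_integral => x _; rewrite gee0_abs // nneseries_ge0.
  by apply: ae_impl => x; apply.
have step n x : S x -> D n x <= fine (T x) * (2^-1 ^+ n) ^+ 2.
  move=> Sx.
  have : ((4 ^+ n * D n x)%:E <= T x)%E.
    apply: le_trans (nneseries_lim_ge n.+1 _) => //.
    rewrite big_nat_recr //= leeDr //; apply: sume_ge0 => i _; exact: T0.
  rewrite -{1}(fineK Sx) lee_fin => H.
  rewrite -exprM mulnC exprM (_ : 2^-1 ^+ 2 = 4^-1 :> R); last by field.
  by rewrite exprVn ler_pdivlMr ?exprn_gt0 // mulrC.
have stepS n x : S x -> forall y, `|y| ^+ 2 <= D n x ->
    `|y| <= Num.sqrt (fine (T x)) * 2^-1 ^+ n.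
  move=> Sx y yD; rewrite -ler_sqr ?nnegrE ?mulr_ge0 ?sqrtr_ge0 ?exprn_ge0 ?invr_ge0 //.
  rewrite exprMn sqr_sqrtr ?(le_trans yD (step _ _ Sx)) //.
  by apply: fine_ge0; apply: nneseries_ge0.
(* Off [S] the sequence is replaced by zero, so that it converges everywhere and
   its pointwise limit is measurable. *)
pose restr (p : R[i] -> R) n x := \1_S x * p (w n x).
have cvgp (p : R[i] -> R) : (forall z c, p (z - c) = p z - p c) ->
    (forall z, `|p z| ^+ 2 <= abs2 z) -> forall x, cvgn (restr p ^~ x).
  move=> pB p2 x; rewrite /restr indicE; case: (boolP (x \in S)) => [/set_mem Sx|_].
    under eq_fun do rewrite mul1r.
    apply: (geometric_steps_cvg (sqrtr_ge0 (fine (T x)))) => n.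
    by apply: stepS => //; rewrite -pB.
  by under eq_fun do rewrite mul0r; exact: is_cvg_cst.
have cr := cvgp (@complex.Re R) ReB abs2_Re.
have ci := cvgp (@complex.Im R) ImB abs2_Im.
exists (fun x => limn (restr (@complex.Re R) ^~ x) +i* limn (restr (@complex.Im R) ^~ x)).
  split.
    apply: (@measurable_fun_cvg _ _ _ _ (restr (@complex.Re R))) => [n|x _].
      by apply: measurable_funM; [exact: measurable_indic|case: (mw n)].
    exact: cr.
  apply: (@measurable_fun_cvg _ _ _ _ (restr (@complex.Im R))) => [n|x _].
    by apply: measurable_funM; [exact: measurable_indic|case: (mw n)].
  exact: ci.
apply: ae_impl aeS => x Sx /=.
have E p : restr p ^~ x = fun n => p (w n x).
  by apply/funext => n; rewrite /restr indicE mem_set // mul1r.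
by split; [have := cr x|have := ci x]; rewrite !E.
Qed.

End RieszFischer.

Section Completeness.
Context {R : realType}.
Implicit Types (l : R -> R[i]) (e : R).

(** A subsequence [p] along which the distances decrease fast converges almost
    everywhere; the lemma of Fatou turns the Cauchy condition along it into a bound
    on the distance to the limit. *)
Lemma riesz_fischer (v : nat -> R -> R[i]) : (forall n, inL2 (v n)) ->
  (forall e, 0 < e -> exists N, forall m n, (N <= m)%N -> (N <= n)%N ->
    (L2norm (fun x => v m x - v n x)%R ^+ 2 < e%:E)%E) ->
  exists2 l, inL2 l & forall e, 0 < e -> exists N, forall n, (N <= n)%N ->
    (L2norm (fun x => l x - v n x)%R ^+ 2 < e%:E)%E.
Proof.
move=> v2 vcauchy.
have /choice[N NP] : forall k, exists N, forall m n, (N <= m)%N -> (N <= n)%N ->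
    (L2norm (fun x => v m x - v n x)%R ^+ 2 < (8^-1 ^+ k)%:E)%E.
  by move=> k; apply: vcauchy; rewrite exprn_gt0 ?invr_gt0.
(* Summing the successors of the thresholds makes [p] at least the threshold, at
   least the identity, and increasing. *)
pose p k := (\sum_(i < k.+1) (N i).+1)%N.
have pS k : p k.+1 = (p k + (N k.+1).+1)%N by rewrite /p big_ord_recr.
have pN k : (N k <= p k)%N.
  by rewrite /p big_ord_recr /=; apply: leq_trans (leqnSn _) (leq_addl _ _).
have p_ge k : (k <= p k)%N.
  by elim: k => // k IH; rewrite pS addnS ltnS (leq_trans IH) ?leq_addr.
have vm n : cmeasurable (v n) by apply: inL2_cmeasurable.
have [|k|l ml vl] := @fast_cauchy_ae_cvg _ (fun k => v (p k)) => //.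
  rewrite -L2norm_sqr ltW // NP // (leq_trans (pN k)) // pS leq_addr //.
have tail e : 0 < e -> exists N, forall n, (N <= n)%N ->
    (L2norm (fun x => l x - v n x)%R ^+ 2 < e%:E)%E.
  move=> e0; have e2 : 0 < e / 2 by rewrite divr_gt0.
  have [N0 HN0] := vcauchy _ e2; exists N0 => n N0n.
  apply: (@le_lt_trans _ _ (e / 2)%:E); last by rewrite lte_fin; lra.
  rewrite L2norm_sqr.
  apply: (fatou_abs2 (u := fun m x => v (p (m + N0)%N) x - v n x)).
  - by move=> m; apply: cmeasurableB.
  - exact: cmeasurableB.
  - apply: ae_impl vl => x [vr vi].
    rewrite ReB ImB; under eq_fun do rewrite ReB.
    split; last under eq_fun do rewrite ImB.
      apply: cvgB; last exact: cvg_cst.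
      by rewrite (cvg_shiftn N0 (fun m => complex.Re (v (p m) x))).
    apply: cvgB; last exact: cvg_cst.
    by rewrite (cvg_shiftn N0 (fun m => complex.Im (v (p m) x))).
  - move=> m; rewrite -L2norm_sqr ltW // HN0 //.
    by rewrite (leq_trans _ (p_ge _)) // leq_addl.
exists l => //; have [N0 /(_ _ (leqnn _)) H] := tail 1 ltr01.
have -> : l = (fun x => (l x - v N0 x) + v N0 x) by apply/funext => x; rewrite subrK.
apply: inL2D => //.
have [mr mi] := cmeasurableB ml (vm N0); split=> //.
by rewrite L2norm_lty -L2norm_sqr (lt_trans H) // ltry.
Qed.

End Completeness.

(** * The semi-Hilbert space of square-integrable functions *)

Section L2space.
Context {R : realType}.
Implicit Types (f h : R -> R[i]).

Definition L2pred : {pred (R -> R[i])} := fun f => `[< inL2 f >].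

Lemma L2predP f : reflect (inL2 f) (f \in L2pred).
Proof. exact: asboolP. Qed.

Lemma L2pred_submod_closed : submod_closed L2pred.
Proof.
split; first exact/L2predP/inL20.
by move=> c f h /L2predP f2 /L2predP h2; apply/L2predP/inL2D => //; apply: inL2Z.
Qed.

HB.instance Definition _ := GRing.isSubmodClosed.Build _ _ L2pred L2pred_submod_closed.

Record L2fun := SquareInt { L2fun_val :> R -> R[i]; _ : L2fun_val \in L2pred }.
HB.instance Definition _ := [isSub for L2fun_val].
HB.instance Definition _ := gen_eqMixin L2fun.
HB.instance Definition _ := gen_choiceMixin L2fun.
HB.instance Definition _ := [SubChoice_isSubLmodule of L2fun by <:].

Lemma L2funP (F : L2fun) : inL2 F.
Proof. by case: F => f /= /L2predP. Qed.

Definition toL2 f (f2 : inL2 f) : L2fun := SquareInt (introT (L2predP f) f2).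

Lemma L2fun_add (F G : L2fun) x : (F + G) x = F x + G x. Proof. by []. Qed.
Lemma L2fun_sub (F G : L2fun) x : (F - G) x = F x - G x. Proof. by []. Qed.
Lemma L2fun_scale c (F : L2fun) x : (c *: F) x = c * F x. Proof. by []. Qed.

Lemma L2fun_sum (I : Type) (s : seq I) (F : I -> L2fun) x :
  (\sum_(k <- s) F k) x = \sum_(k <- s) F k x.
Proof. by elim/big_rec2: _ => // k y G _ <-. Qed.

Lemma L2norm_inner (F : L2fun) :
  (L2norm F ^+ 2 = (complex.Re (L2inner F F))%:E)%E.
Proof. exact/L2norm_sqr_fin/L2funP. Qed.

Lemma L2inner_ge0 f : 0 <= complex.Re (L2inner f f).
Proof. by rewrite Re_L2inner; apply: Rintegral_ge0 => x _; apply: abs2_ge0. Qed.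

Lemma L2fun_complete (v : nat -> L2fun) :
  (forall e, 0 < e -> exists N, forall m n, (N <= m)%N -> (N <= n)%N ->
       complex.Re (L2inner (v m - v n : L2fun) (v m - v n : L2fun)) < e) ->
    exists l : L2fun, forall e, 0 < e -> exists N, forall n, (N <= n)%N ->
       complex.Re (L2inner (l - v n : L2fun) (l - v n : L2fun)) < e.
Proof.
move=> vc; have [|e /vc[N H]|l l2 lP] := @riesz_fischer _ (fun n => v n).
- by move=> n; apply: L2funP.
- by exists N => m n Nm Nn; rewrite (L2norm_inner (v m - v n)) lte_fin H.
- exists (toL2 l2) => e /lP[N H]; exists N => n /H.
  by rewrite (L2norm_inner (toL2 l2 - v n)) lte_fin.
Qed.

HB.instance Definition _ := Lmodule_isSemiHilbert.Build R L2fun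
  (fun x y z => L2innerDl (L2funP x) (L2funP y) (L2funP z))
  (fun c x z => L2innerZl c (L2funP x) (L2funP z))
  (fun x y => L2innerC (L2funP x) (L2funP y))
  (fun x => L2inner_ge0 x)
  L2fun_complete.

End L2space.

(** * Translations *)

Section Translation.
Context {R : realType}.
Implicit Types (f : R -> R[i]) (t : R).
Local Notation mu := (@lebesgue_measure R).

Lemma measurable_subr t : measurable_fun setT (fun x : R => x - t).
Proof. by apply: measurable_funB. Qed.

(** By uniqueness of the Lebesgue measure: the image measure has the same value
    on half-open intervals. *)
Lemma lebesgue_measure_translation t (A : set R) : measurable A ->
  mu ((fun x => x - t) @^-1` A) = mu A.
Proof.
move=> mA; rewrite -[LHS]/(pushforward mu (fun x : measurableTypeR R =>
  (x - t : measurableTypeR R)) A).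
apply/esym/lebesgue_measure_unique => //=; first exact: measurable_subr.
move=> msub _ [[a b]] _ <-; rewrite /pushforward.
have -> : (fun x => x - t) @^-1` `]a, b]%classic = `]a + t, b + t]%classic.
  by apply/seteqP; split=> x /=; rewrite !in_itv /= ltrBrDr lerBlDr.
by rewrite !lebesgue_measure_itv /= !lte_fin ltrD2r -!EFinD; case: ifP => // _;
  congr EFin; ring.
Qed.

Lemma ae_translation t (P : R -> Prop) : {ae mu, forall x, P x} ->
  {ae mu, forall x, P (x - t)}.
Proof.
case=> N [mN N0 PN]; exists ((fun x => x - t) @^-1` N); split.
- by rewrite -[_ @^-1` _]setTI; apply: measurable_subr.
- by rewrite lebesgue_measure_translation.
- by move=> x; apply: PN.
Qed.

Lemma ge0_integral_translation t (u : R -> \bar R) : measurable_fun setT u ->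
  (forall x, (0 <= u x)%E) -> (\int[mu]_x u (x - t)%R = \int[mu]_x u x)%E.
Proof.
move=> mu_ u0.
have H := @ge0_integral_pushforward _ _ (measurableTypeR R) (measurableTypeR R)
  R _ (measurable_subr t) (@lebesgue_measure R) setT u measurableT mu_ (fun x _ => u0 x).
rewrite preimage_setT in H; rewrite -[LHS]H.
apply: eq_measure_integral; first exact: measurable_subr.
by move=> msub A mA _; exact: lebesgue_measure_translation.
Qed.

Lemma cmeasurable_translation t f : cmeasurable f -> cmeasurable (translation t f).
Proof.
case=> mr mi; split; first exact: (measurableT_comp mr (measurable_subr t)).
exact: (measurableT_comp mi (measurable_subr t)).
Qed.

End Translation.

(** * Gabor systems *)

Section Gabor.
Context {R : realType}.
Implicit Types (f : R -> R[i]) (a b x : R).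

Definition cis x : R[i] := cos x +i* sin x.

Lemma abs2_cis x : abs2 (cis x) = 1.
Proof. by rewrite /abs2 /= cos2Dsin2. Qed.

Lemma cisD x y : cis (x + y) = cis x * cis y.
Proof. by rewrite /cis cosD sinD; congr Complex; ring. Qed.

Lemma cis_conj x : cis x * (cis x)^* = 1.
Proof.
rewrite /cis; congr Complex; last by ring.
by rewrite -(cos2Dsin2 x); ring.
Qed.

Lemma cmeasurable_modulation nu f : cmeasurable f -> cmeasurable (modulation nu f).
Proof.
have ml : measurable_fun setT (fun x : R => 2 * pi * nu * x) by apply: measurable_funM.
apply: cmeasurableM; split.
  apply: (measurableT_comp _ ml); apply: continuous_measurable_fun; exact: continuous_cos.
apply: (measurableT_comp _ ml); apply: continuous_measurable_fun; exact: continuous_sin.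
Qed.

Lemma L2norm_gabor a b f mn : cmeasurable f ->
  (L2norm (gabor a b f mn) ^+ 2 = L2norm f ^+ 2)%E.
Proof.
move=> mf; rewrite !L2norm_sqr.
rewrite -(@ge0_integral_translation _ (mn.2%:~R * a) (fun x => (abs2 (f x))%:E)).
- apply: eq_integral => x _; congr EFin.
  by rewrite /gabor /modulation abs2M abs2_cis mul1r.
- by apply/measurable_EFinP; apply: measurable_abs2.
- by move=> x; rewrite lee_fin abs2_ge0.
Qed.

Lemma gabor_inL2 a b f mn : inL2 f -> inL2 (gabor a b f mn).
Proof.
move=> f2; have mf := inL2_cmeasurable f2.
have [mr mi] : cmeasurable (gabor a b f mn).
  by apply: cmeasurable_modulation; apply: cmeasurable_translation.
split=> //; case: (f2) => _ _; rewrite !L2norm_lty.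
by rewrite -!L2norm_sqr L2norm_gabor.
Qed.

Definition gaborL2 a b (F : @L2fun R) mn : L2fun :=
  toL2 (gabor_inL2 a b mn (L2funP F)).

Lemma L2fun_ext (F G : @L2fun R) : (forall x, F x = G x) -> F = G.
Proof. by move=> FG; apply: val_inj; apply/funext. Qed.

Lemma gaborL2D a b mn F G : gaborL2 a b (F + G) mn = gaborL2 a b F mn + gaborL2 a b G mn.
Proof. by apply: L2fun_ext => x; apply: mulrDr. Qed.

Lemma gaborL2B a b mn F G : gaborL2 a b (F - G) mn = gaborL2 a b F mn - gaborL2 a b G mn.
Proof. by apply: L2fun_ext => x; apply: mulrBr. Qed.

Lemma gaborL2Z a b mn c F : gaborL2 a b (c *: F) mn = c *: gaborL2 a b F mn.
Proof. by apply: L2fun_ext => x; apply: mulrCA. Qed.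

Lemma sqn_gaborL2 a b mn F : sqn (gaborL2 a b F mn) = sqn F.
Proof.
apply/EFin_inj; rewrite -!L2norm_inner; apply: L2norm_gabor.
exact/inL2_cmeasurable/L2funP.
Qed.

Lemma ip_gaborL2 a b mn F G : ip (gaborL2 a b F mn) (gaborL2 a b G mn) = ip F G.
Proof.
apply: (isometry_ip (T := fun F => gaborL2 a b F mn)).
- exact: gaborL2D.
- exact: gaborL2Z.
- exact: sqn_gaborL2.
Qed.

(** The phase e^(-2 pi i (m b) (n a)) is the price of moving the translation of
    [q] across the modulation of [p]. *)
Lemma gaborL2_comp a b (p q : int * int) F :
  gaborL2 a b (gaborL2 a b F p) q =
  cis (- (2 * pi * (p.1%:~R * b) * (q.2%:~R * a))) *: gaborL2 a b F (p.1 + q.1, p.2 + q.2).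
Proof.
apply: L2fun_ext => x; rewrite L2fun_scale /=.
rewrite /gabor /modulation /translation /= -!/(cis _) !mulrA -!cisD.
congr (cis _ * F _); first by rewrite rmorphD /=; ring.
by rewrite rmorphD /=; ring.
Qed.

(** The shift by [q] is unitary and permutes the shifts of [U] and of [W] up to
    the phases of [gaborL2_comp].  The term of index [p] acquires the same phase in
    [U] and in [W]; the one in [U] is conjugated by the inner product, and the two
    cancel. *)
Lemma gabor_synthesis_covariant a b G U W S q :
  fsum_to (fun p => ip G (gaborL2 a b U p) *: gaborL2 a b W p) S ->
  fsum_to (fun p => ip (gaborL2 a b G q) (gaborL2 a b U p) *: gaborL2 a b W p)
    (gaborL2 a b S q).
Proof.
move=> /(@fsum_to_isometry _ _ _ _ _ (fun F => gaborL2 a b F q)) => H.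
apply: (fsum_to_reindex (f := fun p : int * int => (p.1 + q.1, p.2 + q.2))
  (g := fun p => Some (p.1 - q.1, p.2 - q.2)) _ _ _ (H _ _)).
- by case=> i j /=; rewrite !addrK.
- by case=> i j /=; rewrite !subrK.
- case=> i j /=; rewrite -(ip_gaborL2 a b q G) gaborL2Z.
  rewrite (gaborL2_comp a b _ q U) (gaborL2_comp a b _ q W) /= !subrK.
  by rewrite ipZr scalerA mulrAC [X in X * ip _ _]mulrC cis_conj mul1r.
- exact: gaborL2D.
- exact: sqn_gaborL2.
Qed.

End Gabor.

(** * Frames, sums and supports of functions *)

Section Dictionary.
Context {R : realType}.
Implicit Types (f h : R -> R[i]).
Local Notation mu := (@lebesgue_measure R).

Lemma L2norm_sqrt (F : @L2fun R) : L2norm F = (Num.sqrt (sqn F))%:E.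
Proof.
have := L2norm_inner F; have := L2norm_ge0 F; have [_ _] := L2funP F.
case: (L2norm F) => [r _|//|//]; rewrite lee_fin => r0.
by rewrite -/(sqn F) -EFin_expe => -[<-]; rewrite sqrtr_sqr ger0_norm.
Qed.

Lemma L2sum_toP (I : countType) (u : I -> R -> R[i]) (U : I -> @L2fun R)
    h (H : @L2fun R) : (forall k x, u k x = U k x) -> (forall x, h x = H x) ->
  L2sum_to u h <-> fsum_to U H.
Proof.
move=> uU hH; have -> : h = H by apply/funext.
have E (J : {fset I}) :
    L2norm (fun x => H x - \sum_(k <- J) u k x) =
    (Num.sqrt (sqn (H - \sum_(k <- J) U k)))%:E.
  rewrite -L2norm_sqrt; congr L2norm; apply/funext => x.
  by rewrite L2fun_sub L2fun_sum; congr (_ - _); apply: eq_bigr => k _.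
have totallyF : ProperFilter (@totally I) by exact: totally_filter.
rewrite /L2sum_to; under eq_fun do rewrite E.
split=> [[_ /fine_cvgP[_ /cvgr0Pnorm_lt cv]] e e0|UH].
  have /cv[J0 _ J0P] : 0 < Num.sqrt e by rewrite sqrtr_gt0.
  exists J0 => J /J0P /=; rewrite ger0_norm ?sqrtr_ge0 // ltr_sqrt //.
split; first exact: L2funP.
apply/fine_cvgP; split; first exact: nearW.
apply/cvgr0Pnorm_lt => e e0; have [J0 J0P] := UH _ (exprn_gt0 2 e0).
exists J0 => // J /J0P /=; rewrite ger0_norm ?sqrtr_ge0 // => lt_e.
by rewrite -[e]ger0_norm ?ltW // -sqrtr_sqr ltr_sqrt // exprn_gt0.
Qed.

Lemma frame_sum_ge (I : countType) (U : I -> @L2fun R) (F : @L2fun R) (J : {fset I}) :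
  ((\sum_(k <- J) abs2 (ip F (U k)))%:E <= frame_sum (fun k => U k : R -> R[i]) F)%E.
Proof.
apply: esum_ge; exists [set` J]; first by split.
rewrite fsbig_finite // set_fsetK -sumEFin; apply: lee_sum => k _.
by rewrite sqr_normc_abs2.
Qed.

Lemma frame_sum_le (I : countType) (U : I -> @L2fun R) (F : @L2fun R) (M : R) :
  (forall J : {fset I}, \sum_(k <- J) abs2 (ip F (U k)) <= M) ->
  (frame_sum (fun k => U k : R -> R[i]) F <= M%:E)%E.
Proof.
move=> FM; apply: ge_ereal_sup => _ [X [finX _] <-].
rewrite fsbig_finite // sumEFin lee_fin; apply: le_trans (FM (fset_set X)).
by apply: ler_sum => k _; rewrite sqr_normc_abs2.
Qed.

Lemma bessel_sequenceP (I : countType) (U : I -> @L2fun R) :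
  bessel_sequence (fun k => U k : R -> R[i]) <-> exists2 B, 0 < B & bessel B U.
Proof.
split=> [[_ [B B0 UB]]|[B B0 UB]].
  exists B => // F J; have := UB F (L2funP F).
  rewrite L2norm_inner -EFinM => /(le_trans (frame_sum_ge U F J)).
  by rewrite lee_fin.
split; first by move=> k; apply: L2funP.
exists B => // f f2; rewrite (L2norm_inner (toL2 f2)) -EFinM.
by apply: (frame_sum_le (F := toL2 f2)) => J; apply: UB.
Qed.

(** The lower bound costs nothing: [F] is synthesized from its own coefficients
    <F, W_k> along a Bessel family, so |F|^2 <= 2 B sum_k |<F, W_k>|^2. *)
Lemma frame_of_synthesis (I : countType) (U W : I -> @L2fun R) (B B' : R) :
  0 < B -> bessel B U -> 0 < B' -> bessel B' W ->
  (forall F, fsum_to (fun k => ip F (W k) *: U k) F) ->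
  frame (fun k => W k : R -> R[i]).
Proof.
move=> B0 UB B'0 WB' UW; split; first by apply/bessel_sequenceP; exists B'.
exists (2 * B)^-1; first by rewrite invr_gt0 mulr_gt0.
move=> f f2; pose F := toL2 f2; rewrite (L2norm_inner F) -EFinM.
have : (0 <= frame_sum (fun k => W k : R -> R[i]) F)%E.
  by apply: esum_ge0 => k _; rewrite lee_fin sqr_ge0.
have := frame_sum_ge W F.
rewrite -[frame_sum _ f]/(frame_sum _ F).
case: (frame_sum _ F) => [M|_ _|//]; last by rewrite leey.
move=> FM _; rewrite lee_fin mulrC ler_pdivrMr ?mulr_gt0 //.
have : sqn F <= 2 * (B * M).
  apply: (sqn_fsum_le B0 UB _ (UW F)) => J.
  by have := FM J; rewrite lee_fin.
by rewrite -/(sqn F) mulrA [M * _]mulrC.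
Qed.

Lemma ae_eq_sqn0 (F G : @L2fun R) :
  {ae mu, forall x, F x = G x} <-> sqn (F - G) = 0.
Proof.
split=> FG.
  rewrite /sqn -[ip _ _]/(L2inner (F - G) (F - G)) L2inner_ae0 //; try exact: L2funP.
  by apply: ae_impl FG => x FG; rewrite L2fun_sub FG subrr mul0r.
by apply: ae_impl (L2norm_eq0_ae (L2funP (F - G)) FG) => x /eqP;
  rewrite L2fun_sub subr_eq0 => /eqP.
Qed.

(** Supports are measured by a radius, which behaves additively under
    translations. *)
Definition vanishes_beyond (M : R) f : Prop :=
  {ae mu, forall x, M < `|x| -> f x = 0}.

Lemma compactly_supportedP f :
  compactly_supported f <-> exists M, vanishes_beyond M f.
Proof.
split=> [[A cA fA]|[M fM]].
  have [M0 [_ /(_ (M0 + 1))]] := compact_bounded cA.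
  rewrite ltrDl ltr01 => /(_ isT) AM.
  exists (M0 + 1); apply: ae_impl fA => x fx Mx; apply: fx => /AM /=.
  by rewrite leNgt Mx.
exists `[- M, M]%classic; first exact: segment_compact.
apply: ae_impl fM => x fx xM; apply: fx; rewrite ltNge; apply/negP => xM'.
by apply: xM; rewrite /= in_itv /= -ler_norml.
Qed.

Lemma vanishes_beyond_le M M' f : M <= M' -> vanishes_beyond M f ->
  vanishes_beyond M' f.
Proof.
by move=> MM'; apply: ae_impl => x fx Mx; apply: fx; apply: le_lt_trans Mx.
Qed.

Lemma vanishes_beyond_gabor a b M f mn : vanishes_beyond M f ->
  vanishes_beyond (M + `|mn.2%:~R * a|) (gabor a b f mn).
Proof.
move=> /(ae_translation (mn.2%:~R * a)); apply: ae_impl => x fx Mx.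
rewrite /gabor /modulation /translation fx ?mulr0 //.
by have := ler_normB x (mn.2%:~R * a); have := lerB_dist x (mn.2%:~R * a); lra.
Qed.

(** Let [Z] be the part of [F] outside the ball of radius [M].  It is orthogonal to
    every [U k], hence to the sum [F]; but <F, Z> = |Z|^2. *)
Lemma vanishes_beyond_fsum (I : choiceType) (U : I -> @L2fun R) (F : @L2fun R) M :
  (forall k, vanishes_beyond M (U k)) -> fsum_to U F -> vanishes_beyond M F.
Proof.
move=> UM UF.
pose D := [set x : R | M < `|x|].
have mD : measurable D.
  have -> : D = ~` `[- M, M]%classic.
    by apply/seteqP; split=> x; rewrite /D /= in_itv /= -ler_norml ltNge => /negP.
  exact: measurableC.
have Z2 : inL2 (fun x => (\1_D x)%:C * F x).
  apply: (dominated_inL2 (c := 1) _ (L2funP F)).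
    apply: cmeasurableM (inL2_cmeasurable (L2funP F)).
    by split=> //=; exact: measurable_indic.
  move=> x; rewrite mul1r abs2M /abs2 /= expr0n addr0 indicE.
  by case: (_ \in _); rewrite /= ?expr1n ?mul1r // expr0n mul0r abs2_ge0.
pose Z := toL2 Z2.
have UZ k : ip (U k) Z = 0.
  apply: L2inner_ae0; try exact: L2funP.
  apply: ae_impl (UM k) => x Ux; rewrite /= rmorphM /= indicE.
  case: (boolP (x \in D)) => [/set_mem/Ux ->|_]; first by rewrite mul0r.
  by rewrite !rmorph0 mul0r mulr0.
have FZ : ip F Z = 0.
  rewrite -(ip0l (0 : @L2fun R)); apply: (fsum_to_ip UF (@fsum_to0 _ _ I)) => k.
  by rewrite UZ ip0l.
have ZZ : sqn Z = 0.
  suff E : ip Z Z = ip F Z by rewrite /sqn E FZ.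
  rewrite -[LHS]/(cintegral _) -[RHS]/(cintegral _); congr cintegral.
  apply/funext => x; rewrite /= indicE.
  by case: (x \in D); case: (F x) => p q; rewrite /=; congr Complex; ring.
apply: ae_impl (L2norm_eq0_ae (L2funP Z) ZZ) => x /= + Mx.
by rewrite indicE mem_set // => /eqP; rewrite mulf_eq0 => /orP[|/eqP //];
  rewrite eq_complex /= oner_eq0.
Qed.

End Dictionary.

(** * Compactly supported dual windows *)

Section GaborDuals.
Context {R : realType}.
Implicit Types (g gd : R -> R[i]) (a b M : R).

(** At almost every point either g^d vanishes or the translate of g does. *)
Lemma L2inner_gabor_far a b g gd M M' (p : int * int) : inL2 g -> inL2 gd ->
  vanishes_beyond M g -> vanishes_beyond M' gd -> M + M' < `|p.2%:~R * a| ->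
  L2inner gd (gabor a b g p) = 0.
Proof.
move=> g2 gd2 gM gdM' far; apply: L2inner_ae0 => //; first exact: gabor_inL2.
apply: ae_impl (ae_and (ae_translation (p.2%:~R * a) gM) gdM') => x [gx gdx].
have [/gdx ->|xM'] := ltP M' `|x|; first by rewrite mul0r.
rewrite /gabor /modulation /translation gx ?mulr0 ?rmorph0 ?mulr0 //.
by have := ler_normB x (x - p.2%:~R * a); rewrite subKr; lra.
Qed.

Lemma int_ball_finite (N : nat) :
  exists K : {fset int}, forall k, k \notin K -> (N < `|k|)%N.
Proof.
exists (seq_fset tt [seq i%:Z - N%:Z | i <- iota 0 (N + N).+1]) => k.
rewrite seq_fsetE => kK; rewrite ltnNge; apply: contra kK => kN.
have {}kN : (`|(k : int)| <= N)%N := kN.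
apply/mapP; exists `|((k : int) + N%:Z)%R|%N; first by rewrite mem_iota; lia.
by apply: (@eq_trans int _ ((k : int) + N%:Z - N%:Z)); lia.
Qed.

(** One column of the series over (m, n) is a Bessel family again, and its
    coefficients are square summable because the shifts of [G] are Bessel. *)
Lemma gabor_series_exists a b (Bg Bw : R) (G D W : @L2fun R) (k : int) :
  bessel Bg (gaborL2 a b G) -> 0 < Bw -> bessel Bw (gaborL2 a b W) ->
  exists S : L2fun,
    fsum_to (fun j : int => ip D (gaborL2 a b G (j, k)) *: gaborL2 a b W (j, k)) S.
Proof.
move=> GB Bw0 WB; have pair_inj : injective (fun j : int => (j, k)) by move=> ? ? [].
have [S SP] := bessel_fsum_exists Bw0 (bessel_reindex pair_inj WB)
  (bessel_reindex pair_inj GB D).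
by exists S.
Qed.

Lemma gabor_series_sum a b (G D W : @L2fun R) (K : {fset int}) (S : int -> L2fun) :
  (forall j k, k \notin K -> ip D (gaborL2 a b G (j, k)) = 0) ->
  (forall k, k \in K ->
    fsum_to (fun j => ip D (gaborL2 a b G (j, k)) *: gaborL2 a b W (j, k)) (S k)) ->
  fsum_to (fun p => ip D (gaborL2 a b G p) *: gaborL2 a b W p) (\sum_(k <- K) S k).
Proof.
by move=> far SP; apply: fsum_to_fibers => // j k /far ->; rewrite scale0r.
Qed.

End GaborDuals.

Theorem theorem1p1 (R : realType) (g gd : R -> R[i]) (a : R) :
  inL2 g -> compactly_supported g ->
  inL2 gd -> compactly_supported gd ->
  0 < a ->
  exists K : {fset int}, forall b : R, 0 < b ->
    frame (gabor a b g) ->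
    dual_frame (gabor a b g) (gabor a b gd) ->
    let admissible (w : R -> R[i]) :=
      [/\ inL2 w, compactly_supported w & bessel_sequence (gabor a b w)] in
    let series_to (w : R -> R[i]) (k : int) (s : R -> R[i]) :=
      L2sum_to
        (fun (j : int) x => L2inner gd (gabor a b g (j, k)) * gabor a b w (j, k) x)
        s in
    (forall w, admissible w ->
       forall k, k \in K -> exists s, series_to w k s) /\
    (forall phi : R -> R[i], inL2 phi ->
       (compactly_supported phi /\ dual_window a b g phi) <->
       (exists2 w, admissible w &
          exists2 s : int -> R -> R[i],
            (forall k, k \in K -> series_to w k (s k)) &
            {ae @lebesgue_measure R, forall x,
               phi x = gd x + w x - \sum_(k <- K) s k x})).
Proof.
move=> g2 /compactly_supportedP[Mg gM] gd2 /compactly_supportedP[Md gdM] a0.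
have [N aN] : exists N : nat, Mg + Md < N%:R * a.
  exists (Num.truncn ((Mg + Md) / a)).+1.
  by rewrite -ltr_pdivrMr // truncnS_gt.
have [K KP] := int_ball_finite N; exists K => b b0 [gB _] [[gdB _] dual].
pose G := toL2 g2; pose D := toL2 gd2.
have far j k : k \notin K -> ip D (gaborL2 a b G (j, k)) = 0.
  move=> /KP Nk; apply: (L2inner_gabor_far b g2 gd2 gM gdM) => /=.
  apply: lt_le_trans aN _; rewrite normrM (gtr0_norm a0) ler_wpM2r ?(ltW a0) //.
  by rewrite -intr_norm -natr_absz ler_nat ltnW.
have [Bg Bg0 GB] := (bessel_sequenceP (gaborL2 a b G)).1 gB.
have [Bd Bd0 DB] := (bessel_sequenceP (gaborL2 a b D)).1 gdB.
move=> admissible series_to.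
have seriesP w (w2 : inL2 w) k s (S : L2fun) : (forall x, s x = S x) ->
    series_to w k s <->
    fsum_to (fun j => ip D (gaborL2 a b G (j, k)) *: gaborL2 a b (toL2 w2) (j, k)) S.
  exact: L2sum_toP.
split=> [w [w2 _ /(bessel_sequenceP (gaborL2 a b (toL2 w2)))[Bw Bw0 WB]] k _|].
  have [S SP] := gabor_series_exists D k GB Bw0 WB.
  by exists S; apply/(seriesP _ w2 _ _ S).
move=> phi phi2; pose P := toL2 phi2; split.
  case=> cphi [_ [[phiB _] phidual]].
  have [Bp Bp0 PB] := (bessel_sequenceP (gaborL2 a b P)).1 phiB.
  have /choice[S SP] k := gabor_series_exists D k GB Bp0 PB.
  (* With w = phi the double series is the reconstruction of g^d. *)
  exists phi; first by split.
  exists (fun k => S k).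
    by move=> k _; apply/(seriesP _ phi2 _ _ (S k)).
  have Dsum := gabor_series_sum far (fun k _ => SP k).
  have Dphi : fsum_to (fun p => ip D (gaborL2 a b G p) *: gaborL2 a b P p) D.
    exact: (L2sum_toP _ _).1 (phidual gd gd2).1.
  have := fsum_to_unique Dphi Dsum; move/ae_eq_sqn0.
  by apply: ae_impl => x Dx; rewrite -[gd x]/(D x) Dx L2fun_sum addrAC subrr add0r.
case=> w [w2 /compactly_supportedP[Mw wM] wB] [s sP phiE].
have [Bw Bw0 WB] := (bessel_sequenceP (gaborL2 a b (toL2 w2))).1 wB.
(* Outside [K] nothing is known about [s k], which need not be in L^2. *)
have /choice[S SP] k : exists S : @L2fun R, k \in K -> (S : R -> R[i]) = s k.
  have [kK|kK] := boolP (k \in K); last by exists 0.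
  by have [s2 _] := sP k kK; exists (toL2 s2).
have SsP k : k \in K ->
    fsum_to (fun j => ip D (gaborL2 a b G (j, k)) *: gaborL2 a b (toL2 w2) (j, k)) (S k).
  by move=> kK; apply/(seriesP _ w2 _ (s k) (S k)); [rewrite SP|exact: sP].
pose Z := \sum_(k <- K) S k.
have ZP := gabor_series_sum far SsP.
have PE : sqn (P - (D + toL2 w2 - Z)) = 0.
  apply/ae_eq_sqn0; apply: ae_impl phiE => x; rewrite -[phi x]/(P x) => ->.
  rewrite L2fun_sub L2fun_add L2fun_sum; congr (_ - _).
  by rewrite big_seq [RHS]big_seq; apply: eq_bigr => k /SP ->.
have cphi : compactly_supported phi.
  apply/compactly_supportedP.
  pose M := \sum_(k <- K) `|k%:~R * a|.
  have ZM : vanishes_beyond (Mw + M) Z.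
    apply: (vanishes_beyond_fsum _ ZP) => -[j k].
    have [kK|/far ->] := boolP (k \in K); last first.
      by apply: aeW => x _; rewrite L2fun_scale mul0r.
    have kM : `|k%:~R * a| <= M.
      by rewrite /M (bigD1_seq k) //= lerDl sumr_ge0.
    apply: vanishes_beyond_le (lerD (lexx Mw) kM) _.
    apply: ae_impl (vanishes_beyond_gabor a b (j, k) wM) => x wx Mx.
    by rewrite L2fun_scale -[_ x]/(gabor a b w (j, k) x) wx // mulr0.
  exists (Num.max Md (Num.max Mw (Mw + M))).
  apply: ae_impl (ae_and (ae_and phiE ZM) (ae_and gdM wM)) => x [[-> Zx] [dx wx]].
  rewrite !gt_max => /and3P[Mdx Mwx MZx].
  rewrite dx // wx // addr0 sub0r; apply/eqP; rewrite oppr_eq0; apply/eqP.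
  transitivity (Z x); last exact: Zx.
  rewrite L2fun_sum big_seq [RHS]big_seq.
  by apply: eq_bigr => k /SP ->.
have dualG F : fsum_to (fun p => ip F (gaborL2 a b D p) *: gaborL2 a b G p) F.
  exact: (L2sum_toP _ _).1 (dual F (L2funP F)).2.
have [[Bp Bp0 PB] Pdual] : (exists2 B, 0 < B & bessel B (gaborL2 a b P)) /\
    (forall F, fsum_to (fun p => ip F (gaborL2 a b P p) *: gaborL2 a b G p) F).
  apply: (dual_family_of_bessel Bg0 GB Bd0 DB Bw0 WB dualG
    (fun q => gabor_synthesis_covariant q ZP)) => q.
  by rewrite -[RHS]PE -[RHS](sqn_gaborL2 a b q) gaborL2B gaborL2B gaborL2D.
have Psym := dual_family_sym GB Bp0 PB Pdual.
split; first exact: cphi.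
split; first exact: phi2.
split; first exact: (frame_of_synthesis Bg0 GB Bp0 PB Pdual).
move=> h h2; split.
  apply/(L2sum_toP (U := fun p => ip (toL2 h2) (gaborL2 a b G p) *: gaborL2 a b P p)
    (H := toL2 h2)) => //.
apply/(L2sum_toP (U := fun p => ip (toL2 h2) (gaborL2 a b P p) *: gaborL2 a b G p)
    (H := toL2 h2)) => //.
Qed.
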